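(* Let $n\ge 3$ and $2\le m\le n-1$ be integers and let $Z\subset\mathbb P^{n-1}$ be a general complete intersection of multi-degree $(m+1,m+2,\ldots,2m)$. Then there exists a smooth hypersurface $Y\subset\mathbb P^n$ of degree $2m$ such that a double cover $X$ of $\mathbb P^n$ branched along $Y$ has a point $x\in X$ whose variety of minimal rational tangents $\mathcal C_x\subset\mathbb P T_x(X)$ is isomorphic to $Z\subset\mathbb P^{n-1}$ (as projective subvarieties, i.e. some projective isomorphism $\mathbb P T_x(X)\cong\mathbb P^{n-1}$ sends $\mathcal C_x$ to $Z$).
   Context: Everything is over $\mathbb C$. A double cover $\phi:X\to\mathbb P^n$ branched along a smooth hypersurface $Y=\{F=0\}$ of degree $2m$ is a degree-2 finite morphism from a smooth projective variety with branch divisor $Y$; it is realized as the submanifold $\{s^2=F\}$ of the total space of the line bundle $\mathcal O_{\mathbb P^n}(m)$. A rational curve $C\subset X$ with $\phi(C)\not\subset Y$ is a minimal rational curve if it has degree $1$ with respect to $\phi^*\mathcal O_{\mathbb P^n}(1)$. For $x\in X\setminus\phi^{-1}(Y)$, $\mathcal K_x$ denotes the (normalized) space of minimal rational curves through $x$; minimal rational curves are smooth. $\mathbb P T_x(X)$ is the projective space of lines in $T_x(X)$, and the variety of minimal rational tangents $\mathcal C_x\subset\mathbb P T_x(X)$ is the union of the tangent directions at $x$ of the members of $\mathcal K_x$. ''General complete intersection'' means that the tuple of defining polynomials of degrees $m+1,\ldots,2m$ lies in a suitable dense Zariski open subset of the space of such tuples. *)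

(* Defs.v *)
From mathcomp Require Import all_boot all_order all_algebra.
From mathcomp Require Import reals.
From mathcomp Require Export complex mpoly.

Set Implicit Arguments.
Unset Strict Implicit.
Unset Printing Implicit Defensive.

Import Order.TTheory GRing.Theory Num.Theory.
Local Open Scope ring_scope.

(* Points of projective space are given by nonzero vectors of homogeneous
   coordinates, [p.@[v 0]] being the value of [p] at the row vector [v]. *)

Section Projective.
Variable C : numClosedFieldType.

Definition proj_eq k (p q : 'rV[C]_k) : Prop :=
  exists2 a : C, a != 0 & q = a *: p.

Definition dirderiv k (p : {mpoly C[k]}) (v w : 'rV[C]_k) : C :=
  \sum_i w 0 i * (p^`M(i)).@[v 0].

Definition smooth_hypersurface k d (F : {mpoly C[k]}) : Prop :=
  [/\ F != 0, F \is d.-homog &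
      forall z : 'rV[C]_k, z != 0 -> F.@[z 0] = 0 ->
        exists i, (F^`M(i)).@[z 0] != 0].

Definition zero_locus k m (G : 'I_m -> {mpoly C[k]}) (u : 'rV[C]_k) : Prop :=
  u != 0 /\ forall j, (G j).@[u 0] = 0.

End Projective.

Section ZariskiTopology.
Variables (C : numClosedFieldType) (n m : nat).

(* The index [j < m] carries degree [m + j + 1], so that the degrees are
   m+1, ..., 2m. *)
Definition tuple_space (G : 'I_m -> {mpoly C[n]}) : Prop :=
  forall j : 'I_m, G j \is (m + j.+1).-homog.

(* Pairs (j, mu) with mu a monomial of degree at most 2m.  On [tuple_space] the
   coordinates whose monomial has the wrong degree vanish identically, so
   polynomials in these coordinates are exactly the polynomial functions on the
   finite-dimensional vector space [tuple_space]. *)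
Definition coef_index : finType := ('I_m * 'X_{1..n < (2 * m).+1})%type.

Definition coef_coord (G : 'I_m -> {mpoly C[n]}) (i : 'I_#|coef_index|) : C :=
  (G (enum_val i).1)@_(bmnm (enum_val i).2).

Definition zariski_open (U : ('I_m -> {mpoly C[n]}) -> Prop) : Prop :=
  exists S : {mpoly C[#|coef_index|]} -> Prop,
    forall G, tuple_space G ->
      (U G <-> exists2 P, S P & P.@[coef_coord G] != 0).

Definition zariski_dense (U : ('I_m -> {mpoly C[n]}) -> Prop) : Prop :=
  forall V, zariski_open V ->
    (exists2 G, tuple_space G & V G) ->
    exists G, [/\ tuple_space G, U G & V G].

End ZariskiTopology.

(* The total space of O(m) over P^n is the set of pairs (z, s) with z nonzero,
   modulo (z, s) ~ (a z, a^m s) for a nonzero.  The double cover X is the locus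
   s^2 = F(z) in it, and the covering map sends [z, s] to [z]. *)
Notation total_coord C n := ('rV[C]_n.+1 * C^o)%type.

Section DoubleCover.
Variables (C : numClosedFieldType) (n m : nat).
Implicit Type F : {mpoly C[n.+1]}.

Definition same_point (x y : total_coord C n) : Prop :=
  exists2 a : C, a != 0 & y.1 = a *: x.1 /\ y.2 = a ^+ m * x.2.

Definition on_double_cover F (x : total_coord C n) : Prop :=
  x.1 != 0 /\ x.2 ^+ 2 = F.@[x.1 0].

(* The tangent space of X at x = [z, s] is the tangent space at (z, s) of the
   affine locus s^2 = F(z), modulo the line tangent to the orbit of the
   C^*-action, which is spanned by the Euler vector (z, m s). *)
Definition cone_tangent F (x w : total_coord C n) : Prop :=
  2 * x.2 * w.2 = dirderiv F x.1 w.1.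

Definition euler (x : total_coord C n) : total_coord C n := (x.1, m%:R * x.2).

(* A morphism P^1 -> X whose pull-back of O_{P^n}(1) has degree d is given by
   n+1 forms f of degree d without common zero, together with a section g of
   O_{P^1}(d m) such that g^2 = F(f). *)
Definition p1_morphism F d (f : n.+1.-tuple {mpoly C[2]}) (g : {mpoly C[2]})
    : Prop :=
  [/\ forall i, tnth f i \is d.-homog,
      g \is (d * m).-homog,
      forall p : 'rV[C]_2, p != 0 -> exists i, (tnth f i).@[p 0] != 0 &
      g ^+ 2 = F \mPo f].

Definition curve_lift (f : n.+1.-tuple {mpoly C[2]}) (g : {mpoly C[2]})
    (p : 'rV[C]_2) : total_coord C n :=
  (\row_i (tnth f i).@[p 0], g.@[p 0]).

Definition curve_lift_diff (f : n.+1.-tuple {mpoly C[2]}) (g : {mpoly C[2]})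
    (p q : 'rV[C]_2) : total_coord C n :=
  (\row_i dirderiv (tnth f i) p q, dirderiv g p q).

(* Injective outside finitely many points; in characteristic 0 this means
   birational onto the image.  Constant morphisms are excluded. *)
Definition generically_injective (f : n.+1.-tuple {mpoly C[2]})
    (g : {mpoly C[2]}) : Prop :=
  exists B : seq 'rV[C]_2, forall p q : 'rV[C]_2,
    p != 0 -> q != 0 ->
    (forall b, b \in B -> ~ proj_eq b p /\ ~ proj_eq b q) ->
    same_point (curve_lift f g p) (curve_lift f g q) -> proj_eq p q.

(* A rational curve in X is given by its normalization P^1 -> X, and d is its
   degree with respect to the pull-back of O_{P^n}(1). *)
Definition rational_curve F d (f : n.+1.-tuple {mpoly C[2]}) (g : {mpoly C[2]})
    : Prop :=
  p1_morphism F d f g /\ generically_injective f g.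

Definition minimal_rational_curve F (f : n.+1.-tuple {mpoly C[2]})
    (g : {mpoly C[2]}) : Prop :=
  rational_curve F 1 f g /\
  exists2 p : 'rV[C]_2, p != 0 & F.@[(curve_lift f g p).1 0] != 0.

(* The direction of the tangent vector represented by w belongs to C_x.  If the
   curve passes through [x] at [p], then p can be rescaled so that the lift of p
   is the representative x itself.  The image of the differential of the lift at
   p is then the preimage, in the tangent space of the affine locus, of the
   tangent line of the (smooth) curve. *)
Definition vmrt F (x w : total_coord C n) : Prop :=
  (forall a : C, w <> a *: euler x) /\
  exists f g p q,
    [/\ minimal_rational_curve F f g, p != 0, curve_lift f g p = x &
        w = curve_lift_diff f g p q].

(* L restricted to [cone_tangent F x] is surjective with kernel the Euler line,
   i.e. it induces a linear isomorphism T_x(X) -> C^n; the projective isomorphism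
   P T_x(X) -> P^(n-1) that it induces sends C_x to Z. *)
Definition vmrt_proj_iso F (x : total_coord C n) (Z : 'rV[C]_n -> Prop) : Prop :=
  exists L : {linear total_coord C n -> 'rV[C]_n},
    [/\ forall u, exists2 w, cone_tangent F x w & L w = u,
        forall w, cone_tangent F x w ->
          (L w = 0 <-> exists a : C, w = a *: euler x) &
        forall w, cone_tangent F x w -> L w != 0 -> (vmrt F x w <-> Z (L w))].

End DoubleCover.

(* Main.v *)
From HB Require Import structures.
Require Import Defs.
From mathcomp Require Import all_boot all_order all_algebra.
From mathcomp Require Import reals complex mpoly.
From mathcomp Require Import ring zify.

Set Implicit Arguments.
Unset Strict Implicit.
Unset Printing Implicit Defensive.

Import Order.TTheory GRing.Theory Num.Theory.
Local Open Scope ring_scope.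

(** Let [X_n] be the last homogeneous coordinate of P^n, and let the apex be the
    point where all the other coordinates vanish.  The branch divisor attached
    to a tuple [G = (G_0, ..., G_(m-1))] of forms of degrees [m+1, ..., 2m] in
    the other coordinates is the zero locus of
      [F = X_n^(2m) + sum_j X_n^(m-j-1) G_j],
    and the point [x] of the double cover lies over the apex, where [F] is 1.

    A minimal rational curve through [x] is a lifting to the double cover of a
    line through the apex on which [F] is a square.  Let [u] be the direction of
    the line, and [t] its affine coordinate vanishing at the apex, chosen so that
    [X_n = 1].  Along the line [F = 1 + sum_j t^(m+j+1) G_j(u)].  A square root
    of [F] of degree at most [m] with value 1 at the apex must be congruent to 1
    modulo [t^(m+1)] ([square_congr_1]), so it is 1 and all the [G_j(u)] vanish
    ([root_of_vmrt]).  Conversely, if they vanish, [F] is the square of [X_n^m]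
    on the line, which therefore lifts ([vmrt_of_root]).  Thus the variety of
    minimal rational tangents at [x] is exactly the common zero locus of the
    [G_j], under the identification of the tangent space at [x] with C^n given by
    the projection from the apex.

    It remains to see that [F] is smooth for general [G].  The partial
    derivatives of [F] are [n+1] forms of the same degree in [n+1] variables, and
    they have no common zero as soon as the determinant of a Macaulay matrix of
    them is nonzero ([macaulay_nonsingular]).  This determinant is a polynomial
    in the coefficients of [G] ([discr_regular]).  It is 1 for the tuple making
    [F] the Fermat form ([discr_fermat]), so its nonvanishing defines a nonempty
    open set, which is dense because any two nonempty open sets of tuples meet
    along a line joining points of them ([nonvanishing_dense]). *)

(** * Multivariate polynomials and forms *)
Section MultivariatePolynomials.

(** Two ring morphisms, or two derivations along the same point, agree as soon
    as they agree on constants and variables; this is the form in which the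
    identities about substitution and differentiation below are checked. *)
Lemma mpoly_ring_ind (K : comNzRingType) k (P : {mpoly K[k]} -> Prop) :
  (forall c, P c%:MP) -> (forall i, P 'X_i) ->
  (forall p q, P p -> P q -> P (p + q)) ->
  (forall p q, P p -> P q -> P (p * q)) -> forall p, P p.
Proof.
move=> PC PX PD PM p; rewrite [p]mpolyE.
apply: (big_ind P _ PD) => [|mu _]; first by rewrite -mpolyC0.
rewrite -mul_mpolyC mpolyXE_id; apply: (PM) => //.
apply: (big_ind P _ PM) => [|i _]; first by rewrite -mpolyC1.
elim: (mu i) => [|d IH]; first by rewrite expr0 -mpolyC1.
by rewrite exprS; apply: PM.
Qed.

Lemma mwiden_meval (K : comNzRingType) k (p : {mpoly K[k]}) (v : 'I_k.+1 -> K) :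
  (mwiden p).@[v] = p.@[fun i => v (widen_ord (leqnSn k) i)].
Proof.
elim/mpoly_ring_ind: p => [c|i|p q Ep Eq|p q Ep Eq].
- by rewrite mwidenC !mevalC.
- by rewrite mwidenX mnmwiden1 !mevalXU.
- by rewrite mwidenD !mevalD Ep Eq.
- by rewrite mwidenM !mevalM Ep Eq.
Qed.

Lemma mdeg_mnmwiden k (mu : 'X_{1..k}) : mdeg (mnmwiden mu) = mdeg mu.
Proof.
rewrite !mdegE big_ord_recr /= mnmwiden_ordmax addn0.
by apply: eq_bigr => i _; rewrite mnmwiden_widen.
Qed.

Lemma mwiden_homog (K : comNzRingType) k d (p : {mpoly K[k]}) :
  p \is d.-homog -> mwiden p \is d.-homog.
Proof.
move=> /dhomogP hp; rewrite [p]mpolyE raddf_sum big_seq.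
apply: rpred_sum => mu /hp dmu; rewrite /= mwidenZ mwidenX rpredZ //.
by rewrite dhomogX /= mdeg_mnmwiden; apply/eqP.
Qed.

Lemma mderiv_homog (K : comNzRingType) k d i (p : {mpoly K[k]}) :
  p \is d.-homog -> p^`M(i) \is d.-1.-homog.
Proof.
move=> hp; apply/dhomogP => mu; rewrite mcoeff_msupp mcoeff_mderiv => nz.
have : p@_(mu + U_(i)) != 0 by apply: contraNneq nz => ->; rewrite mul0rn.
rewrite -mcoeff_msupp => /(dhomog_mf hp) <- /=.
by rewrite mdegD mdeg1 addn1.
Qed.

(** Homogeneity for a substitution into an arbitrary commutative algebra: it is
    used for scalars, and for substituting multiples of a single variable. *)
Lemma homog_mmap_scale (K : comNzRingType) (A : comNzRingType)
    (f : {rmorphism K -> A}) k d (p : {mpoly K[k]}) (h : 'I_k -> A) (a : A) :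
  p \is d.-homog -> mmap f (fun i => a * h i) p = a ^+ d * mmap f h p.
Proof.
move=> /dhomogP hp; rewrite /mmap mulr_sumr; apply: eq_big_seq => mu /hp dmu.
rewrite mulrCA; congr (_ * _); rewrite /mmap1.
under eq_bigr do rewrite exprMn.
by rewrite big_split /= -expr_sum /= -mdegE dmu.
Qed.

End MultivariatePolynomials.

Section DirectionalDerivatives.
Variables (C : numClosedFieldType) (k : nat).
Implicit Types (p q : {mpoly C[k]}) (v w : 'rV[C]_k).

Lemma dirderivC c v w : dirderiv (c%:MP : {mpoly C[k]}) v w = 0.
Proof. by rewrite /dirderiv big1 // => i _; rewrite mderivC meval0 mulr0. Qed.

Lemma dirderivXU i v w : dirderiv ('X_i : {mpoly C[k]}) v w = w 0 i.
Proof.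
rewrite /dirderiv (bigD1 i) //= big1 => [|j ji].
  have -> : 'X_i^`M(i) = 1 :> {mpoly C[k]}.
    by rewrite mderivX mnm1E eqxx scale1r -{1}[U_(i)%MM]add0m addmK mpolyX0.
  by rewrite meval1 mulr1 addr0.
by rewrite mderivX mnm1E eq_sym (negPf ji) scale0r meval0 mulr0.
Qed.

Lemma dirderivD p q v w : dirderiv (p + q) v w = dirderiv p v w + dirderiv q v w.
Proof.
rewrite /dirderiv -big_split; apply: eq_bigr => i _.
by rewrite mderivD mevalD mulrDr.
Qed.

Lemma dirderivM p q v w :
  dirderiv (p * q) v w = dirderiv p v w * q.@[v 0] + p.@[v 0] * dirderiv q v w.
Proof.
rewrite /dirderiv mulr_suml mulr_sumr -big_split; apply: eq_bigr => i _ /=.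
by rewrite mderivM mevalD !mevalM; ring.
Qed.

Lemma dirderiv_sum (I : finType) (F : I -> {mpoly C[k]}) v w :
  dirderiv (\sum_i F i) v w = \sum_i dirderiv (F i) v w.
Proof.
apply: (big_morph (fun p => dirderiv p v w)) => [p q|]; first exact: dirderivD.
by rewrite -mpolyC0 dirderivC.
Qed.

Lemma dirderivX p d v w :
  dirderiv (p ^+ d.+1) v w = d.+1%:R * p.@[v 0] ^+ d * dirderiv p v w.
Proof.
elim: d => [|d IH]; first by rewrite expr1 expr0 !mul1r.
by rewrite exprS dirderivM IH rmorphXn /= -[in RHS]natr1 exprS; ring.
Qed.

End DirectionalDerivatives.

Section Forms.
Variables (C : numClosedFieldType) (k : nat).
Implicit Types (p q : {mpoly C[k]}) (v w : 'rV[C]_k).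

Lemma form_scale d p v (a : C) :
  p \is d.-homog -> p.@[(a *: v) 0] = a ^+ d * p.@[v 0].
Proof.
move=> hp; rewrite -(homog_mmap_scale idfun _ _ hp).
by apply: meval_eq => i; rewrite mxE.
Qed.

Lemma form_at0 d p : p \is d.-homog -> (0 < d)%N -> p.@[(0 : 'rV_k) 0] = 0.
Proof.
by move=> hp d_gt0; rewrite -(scale0r 0) (form_scale _ _ hp) expr0n gtn_eqF ?mul0r.
Qed.

Lemma form_dirderiv_at0 d p w :
  p \is d.-homog -> (1 < d)%N -> dirderiv p 0 w = 0.
Proof.
move=> hp d_gt1; rewrite /dirderiv big1 // => i _.
by rewrite (form_at0 (mderiv_homog i hp)) ?mulr0 // -ltnS prednK // ltnW.
Qed.

Lemma linear_formE p : p \is 1.-homog -> p = \sum_i p@_U_(i) *: 'X_i.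
Proof.
move=> hp; apply/mpolyP => mu; rewrite raddf_sum /=.
have [/eqP/mdeg1P[i /eqP ->]|dmu] := eqVneq (mdeg mu) 1%N.
  rewrite (bigD1 i) //= big1 ?addr0 => [|j ji].
    by rewrite mcoeffZ mcoeffXU eqxx mulr1.
  by rewrite mcoeffZ mcoeffXU (negPf ji) mulr0.
rewrite (dhomog_nemf_coeff hp dmu) big1 // => i _.
rewrite mcoeffZ mcoeffX; case: eqP => [E|]; last by rewrite mulr0.
by rewrite -E mdeg1 eqxx in dmu.
Qed.

Lemma linear_form_eval p v : p \is 1.-homog -> p.@[v 0] = \sum_i p@_U_(i) * v 0 i.
Proof.
move=> hp; rewrite {1}(linear_formE hp) raddf_sum /=; apply: eq_bigr => i _.
by rewrite mevalZ mevalXU.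
Qed.

Lemma linear_form_add p v w (a b : C) : p \is 1.-homog ->
  p.@[(a *: v + b *: w) 0] = a * p.@[v 0] + b * p.@[w 0].
Proof.
move=> hp; rewrite !linear_form_eval // !mulr_sumr -big_split.
by apply: eq_bigr => i _; rewrite !mxE /=; ring.
Qed.

Lemma linear_form_dirderiv p v w : p \is 1.-homog -> dirderiv p v w = p.@[w 0].
Proof.
move=> hp; rewrite {1}(linear_formE hp) dirderiv_sum linear_form_eval //.
apply: eq_bigr => i _.
by rewrite -mul_mpolyC dirderivM dirderivC mul0r add0r mevalC dirderivXU.
Qed.

End Forms.

(** * Polynomials on a line *)
Section RestrictionToLines.
Variables (C : numClosedFieldType).

(** The integers are infinitely many in characteristic 0, so they cannot all be
    roots. *)
Lemma poly_nonroot (p : {poly C}) : p != 0 -> exists t, p.[t] != 0.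
Proof.
move=> nz; pose s := [seq i%:R : C | i <- iota 0 (size p)].
have uniq_s : uniq s.
  by rewrite map_inj_uniq ?iota_uniq //; apply: mulrIn; apply: oner_neq0.
have /allPn[t _ pt] : ~~ all (root p) s.
  apply/negP => roots_s; have := max_poly_roots nz roots_s uniq_s.
  by rewrite size_map size_iota ltnn.
by exists t.
Qed.

Lemma poly_eq_fun (p q : {poly C}) : (forall t, p.[t] = q.[t]) -> p = q.
Proof.
move=> pq; apply/eqP; rewrite -subr_eq0.
apply: contraT => /poly_nonroot[t]; by rewrite hornerD hornerN pq subrr eqxx.
Qed.

Definition on_line k (v w : 'I_k -> C) (p : {mpoly C[k]}) : {poly C} :=
  mmap polyC (fun i => (v i)%:P + w i *: 'X) p.

Lemma horner_on_line k (v w : 'I_k -> C) p t :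
  (on_line v w p).[t] = p.@[fun i => v i + t * w i].
Proof.
rewrite /on_line /mmap mevalE horner_sum; apply: eq_bigr => mu _.
rewrite hornerM hornerC horner_prod; congr (_ * _); apply: eq_bigr => i _.
by rewrite horner_exp hornerD hornerC hornerZ hornerX mulrC.
Qed.

Lemma size_on_line k d (v w : 'I_k -> C) p :
  p \is d.-homog -> (size (on_line v w p) <= d.+1)%N.
Proof.
move=> /dhomogP hp; rewrite /on_line /mmap big_seq.
apply: (leq_trans (size_sum _ _ _)); apply/bigmax_leqP_seq => mu /hp /= dmu _.
rewrite mul_polyC (leq_trans (size_scale_leq _ _)) // -dmu mdegE.
rewrite /mmap1; elim/big_rec2: _ => [|i q s _ IH]; first by rewrite size_poly1.
apply: (leq_trans (size_polyMleq _ _)).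
have : (size (((v i)%:P + w i *: 'X) ^+ mu i) <= (mu i).+1)%N.
  apply: (leq_trans (size_poly_exp_leq _ _)).
  rewrite ltnS -[leqRHS]mul1n leq_mul2r; apply/orP; right.
  rewrite -subn1 leq_subLR (leq_trans (size_polyD _ _)) // geq_max.
  rewrite (leq_trans (size_polyC_leq1 _)) //.
  by rewrite (leq_trans (size_scale_leq _ _)) // size_polyX.
move=> sz; rewrite -subn1 leq_subLR (leq_trans (leq_add sz IH)) //.
by rewrite addSn addnS add1n.
Qed.

(** The only square root of 1 modulo [X^(m+1)] with constant term 1 is 1, since
    [h^2 - 1 = (h - 1)(h + 1)] and [h + 1] is prime to [X].  As [h] has degree
    at most [m], it equals 1, so nothing remains beyond order [m] in [h^2]. *)
Lemma square_congr_1 m (h s : {poly C}) :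
  (size h <= m.+1)%N -> h.[0] = 1 -> h ^+ 2 = 1 + 'X^(m.+1) * s -> s = 0.
Proof.
move=> sz_h h0 h2.
have Xm_nz : 'X^(m.+1) != 0 :> {poly C} by rewrite -size_poly_eq0 size_polyXn.
have prod : (h - 1) * (h + 1) = 'X^(m.+1) * s.
  by rewrite -subr_sqr expr1n h2 addrAC subrr add0r.
have cop : coprimep 'X^(m.+1) (h + 1).
  rewrite coprimep_expl // coprimep_sym -['X]subr0 coprimep_XsubC.
  by rewrite rootE hornerD h0 hornerC -mulr2n pnatr_eq0.
have dvd : 'X^(m.+1) %| h - 1 by rewrite -(Gauss_dvdpl _ cop) prod dvdp_mulr.
have h1 : h - 1 = 0.
  apply: contraTeq dvd => nz; apply/negP => /(dvdp_leq nz).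
  rewrite size_polyXn leqNgt ltnS (leq_trans (size_polyD _ _)) //.
  by rewrite geq_max sz_h size_polyN size_poly1.
by apply/eqP; move/esym/eqP: prod; rewrite h1 mul0r mulf_eq0 (negPf Xm_nz).
Qed.

End RestrictionToLines.

(** * A determinantal criterion for the absence of common zeros *)
Section MacaulayMatrix.
Variables (C : numClosedFieldType) (k e : nat).
Implicit Types (P : 'I_k -> {mpoly C[k]}) (mu : 'X_{1..k}).

(** In this degree each monomial in [k] variables is divisible by the [e]-th
    power of some variable, by the pigeonhole principle ([mdeg_large]). *)
Definition macaulay_deg := (k * e.-1).+1.

(** All monomials of degree at most [macaulay_deg] are kept, rather than those of
    that exact degree.  For forms [P i] of degree [e] the matrix is then block
    diagonal with respect to the degree. *)
Definition macaulay_index : finType := 'X_{1..k < macaulay_deg.+1}.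

(** A factor [X_i^e] of the monomial is replaced by [P i], for some [i] for which
    there is one.  Hence the matrix is the identity for [P i = X_i^e]. *)
Definition macaulay_row P mu : {mpoly C[k]} :=
  if [pick i | (e <= mu i)%N] is Some i
  then 'X_[(mu - U_(i) *+ e)%MM] * P i else 'X_[mu].

Definition macaulay_mx P : 'M[C]_#|macaulay_index| :=
  \matrix_(a, b) (macaulay_row P (bmnm (enum_val a)))@_(bmnm (enum_val b)).

Lemma le_mnm_deg mu i : (e <= mu i)%N -> (U_(i) *+ e <= mu)%MM.
Proof.
move=> le; apply/mnm_lepP => j; rewrite mulmnE mnm1E.
by case: eqP => [<-|_]; rewrite ?mul1n.
Qed.

Lemma mdeg_large mu : mdeg mu = macaulay_deg -> exists i, (e <= mu i)%N.
Proof.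
move=> dmu; apply/existsP; apply: contraT; rewrite negb_exists => /forallP small.
suff : (mdeg mu < macaulay_deg)%N by rewrite dmu ltnn.
rewrite ltnS mdegE -[k in (k * _)%N]card_ord -sum_nat_const leq_sum // => i _.
by have := small i; rewrite -ltnNge; case: (e).
Qed.

Lemma macaulay_row_homog P mu :
  (forall i, P i \is e.-homog) -> macaulay_row P mu \is (mdeg mu).-homog.
Proof.
move=> hP; rewrite /macaulay_row; case: pickP => [i le|_]; last by rewrite dhomogX.
rewrite -[in mdeg mu](submK (le_mnm_deg le)) mdegD.
apply: dhomogM; first by rewrite dhomogX.
by rewrite mdegMn mdeg1 mul1n.
Qed.

Lemma macaulay_row_root P (z : 'rV[C]_k) mu : mdeg mu = macaulay_deg ->
  (forall i, (P i).@[z 0] = 0) -> (macaulay_row P mu).@[z 0] = 0.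
Proof.
move=> /mdeg_large[i le] Pz; rewrite /macaulay_row; case: pickP => [j _|].
  by rewrite mevalM Pz mulr0.
by move/(_ i); rewrite le.
Qed.

(** At a common zero [z] of the [P i], the rows of degree [macaulay_deg] take the
    value 0, so the vector of the monomials of this degree evaluated at [z] is in the
    kernel.  It is nonzero when [z] is, since it contains the powers of the
    coordinates of [z]. *)
Lemma macaulay_nonsingular P (z : 'rV[C]_k) :
  (forall i, P i \is e.-homog) -> \det (macaulay_mx P) != 0 -> z != 0 ->
  exists i, (P i).@[z 0] != 0.
Proof.
move=> hP detP z_nz; apply/existsP; apply: contraT.
rewrite negb_exists => /forallP Pz.
have {}Pz i : (P i).@[z 0] = 0 by apply/eqP; have := Pz i; rewrite negbK.
pose mon (b : 'I_#|macaulay_index|) : 'X_{1..k} := bmnm (enum_val b).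
pose v : 'cV[C]_#|macaulay_index| := \col_b
  if mdeg (mon b) == macaulay_deg then 'X_[mon b].@[z 0] else 0.
have Mv : macaulay_mx P *m v = 0.
  apply/colP => a; rewrite !mxE.
  have row_a : macaulay_row P (mon a) \is (mdeg (mon a)).-homog.
    exact: macaulay_row_homog.
  (* The product is the value at z of the part of degree macaulay_deg of the row,
     which is the whole row or zero. *)
  have [da|da] := eqVneq (mdeg (mon a)) macaulay_deg; last first.
    apply: big1 => b _; rewrite !mxE.
    case: eqP => [db|]; last by rewrite mulr0.
    by rewrite -/(mon a) -/(mon b) (dhomog_nemf_coeff row_a) ?mul0r //= db eq_sym.
  rewrite -[RHS](macaulay_row_root da Pz).
  rewrite [in RHS](@mpolywE _ _ macaulay_deg.+1 (macaulay_row P (mon a))).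
    rewrite raddf_sum (reindex _ (onW_bij _ (enum_val_bij macaulay_index))) /=.
    apply: eq_bigr => b _; rewrite !mxE mevalZ -/(mon b).
    case: eqP => [//|/eqP db].
    by rewrite (dhomog_nemf_coeff row_a) ?mul0r //= da.
  rewrite msizeE; apply/bigmax_leqP_seq => mu /(dhomog_mf row_a) /= -> _.
  by rewrite da.
have v0 : v = 0.
  have unitM : macaulay_mx P \in unitmx by rewrite unitmxE unitfE.
  by rewrite -[v](mulKmx unitM) Mv mulmx0.
have /rV0Pn[i zi] := z_nz.
have dU : (mdeg (U_(i) *+ macaulay_deg) < macaulay_deg.+1)%N.
  by rewrite mdegMn mdeg1 mul1n.
move/matrixP/(_ (enum_rank (BMultinom dU)) 0): v0.
rewrite !mxE /mon enum_rankK /= mdegMn mdeg1 mul1n eqxx => /eqP.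
by rewrite -mpolyXn rmorphXn /= mevalXU expf_eq0 (negPf zi) andbF.
Qed.

Lemma macaulay_mx_powers P :
  (forall i, P i = 'X_i ^+ e) -> macaulay_mx P = 1%:M.
Proof.
move=> PX; have row mu : macaulay_row P mu = 'X_[mu].
  rewrite /macaulay_row; case: pickP => [i le|//].
  by rewrite PX mpolyXn -mpolyXD (submK (le_mnm_deg le)).
apply/matrixP => a b; rewrite !mxE row mcoeffX.
by rewrite (inj_eq val_inj) (inj_eq enum_val_inj).
Qed.

End MacaulayMatrix.

(** * Nonvanishing loci of polynomial functions on the space of tuples *)
Section RegularFunctions.
Variables (C : numClosedFieldType) (n m : nat).
Implicit Types (G : 'I_m -> {mpoly C[n]}) (h : ('I_m -> {mpoly C[n]}) -> C).

Definition regular h := exists P : {mpoly C[#|coef_index n m|]},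
  forall G, tuple_space G -> h G = P.@[coef_coord G].

Lemma regular_const c : regular (fun=> c).
Proof. by exists c%:MP => G _; rewrite mevalC. Qed.

Lemma regularD h1 h2 : regular h1 -> regular h2 -> regular (fun G => h1 G + h2 G).
Proof.
by case=> P1 E1 [P2 E2]; exists (P1 + P2) => G hG; rewrite mevalD E1 ?E2.
Qed.

Lemma regularM h1 h2 : regular h1 -> regular h2 -> regular (fun G => h1 G * h2 G).
Proof.
by case=> P1 E1 [P2 E2]; exists (P1 * P2) => G hG; rewrite mevalM E1 ?E2.
Qed.

Lemma regular_sum (I : finType) (F : I -> ('I_m -> {mpoly C[n]}) -> C) :
  (forall i, regular (F i)) -> regular (fun G => \sum_i F i G).
Proof.
move=> regF; elim: (index_enum I) => [|i r IH].
  by case: (regular_const 0) => P E; exists P => G /E <-; rewrite big_nil.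
case: (regularD (regF i) IH) => P E; exists P => G /E <-.
by rewrite big_cons.
Qed.

Lemma regular_prod (I : finType) (F : I -> ('I_m -> {mpoly C[n]}) -> C) :
  (forall i, regular (F i)) -> regular (fun G => \prod_i F i G).
Proof.
move=> regF; elim: (index_enum I) => [|i r IH].
  by case: (regular_const 1) => P E; exists P => G /E <-; rewrite big_nil.
case: (regularM (regF i) IH) => P E; exists P => G /E <-.
by rewrite big_cons.
Qed.

Lemma regular_det N (M : ('I_m -> {mpoly C[n]}) -> 'M[C]_N) :
  (forall i j, regular (fun G => M G i j)) -> regular (fun G => \det (M G)).
Proof.
move=> regM; apply: regular_sum => s; apply: regularM; first exact: regular_const.
by apply: regular_prod => i; apply: regM.
Qed.

Lemma regular_coef j (mu : 'X_{1..n < (2 * m).+1}) : regular (fun G => (G j)@_mu).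
Proof.
exists 'X_(enum_rank ((j, mu) : coef_index n m)) => G _.
by rewrite mevalXU /coef_coord enum_rankK.
Qed.

Lemma tuple_space_msize G j : tuple_space G -> (msize (G j) <= (2 * m).+1)%N.
Proof.
move=> hG; rewrite msizeE; apply/bigmax_leqP_seq => mu /(dhomog_mf (hG j)) /= -> _.
by have := ltn_ord j; lia.
Qed.

Lemma nonvanishing_open h : regular h -> zariski_open (fun G => h G != 0).
Proof.
case=> P E; exists (eq P) => G hG; rewrite E //; split=> [nz|[Q <- //]].
by exists P.
Qed.

(** The space of tuples contains the line joining a point [G0] of the given open
    set to [G1].  On this line the two conditions are the nonvanishing of two
    nonzero polynomials in one parameter, whose product has a non-root. *)
Lemma nonvanishing_dense h G1 : regular h -> tuple_space G1 -> h G1 != 0 ->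
  zariski_dense (fun G => h G != 0).
Proof.
case=> P E hG1 hG1_nz V [S openV] [G0 hG0 /openV]; case=> // Q SQ QG0.
pose c0 := coef_coord G0; pose dc i := coef_coord G1 i - c0 i.
pose Gt t j := G0 j + t *: (G1 j - G0 j).
have hGt t : tuple_space (Gt t) by move=> j; rewrite rpredD ?rpredZ ?rpredB.
have onGt (p : {mpoly C[#|coef_index n m|]}) t :
    p.@[coef_coord (Gt t)] = (on_line c0 dc p).[t].
  rewrite horner_on_line; apply: meval_eq => i.
  by rewrite /coef_coord mcoeffD mcoeffZ mcoeffB.
have [|t] := @poly_nonroot C (on_line c0 dc P * on_line c0 dc Q).
  rewrite mulf_neq0 //; [apply: contraNneq hG1_nz|apply: contraNneq QG0] => r0.
    rewrite E //; have := onGt P 1; rewrite r0 horner0 => <-.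
    by apply/eqP/meval_eq => i; rewrite /coef_coord mcoeffD mcoeffZ mcoeffB; ring.
  have := onGt Q 0; rewrite r0 horner0 => <-.
  by apply/eqP/meval_eq => i; rewrite /coef_coord mcoeffD mcoeffZ mcoeffB; ring.
rewrite hornerM mulf_eq0 negb_or -!onGt => /andP[Pt Qt].
by exists (Gt t); split; [|rewrite E|apply/openV => //; exists Q].
Qed.

End RegularFunctions.

(** * The branch form with prescribed lines of even contact *)
Section BranchForm.
Variables (C : numClosedFieldType) (n m : nat).
Implicit Types (G : 'I_m -> {mpoly C[n]}) (z : 'rV[C]_n.+1).

Definition branch_form G : {mpoly C[n.+1]} :=
  'X_ord_max ^+ (2 * m) + \sum_(j < m) 'X_ord_max ^+ (m - j.+1) * mwiden (G j).

Definition apex : 'rV[C]_n.+1 := delta_mx 0 ord_max.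

(** The linear projection from the apex.  Its values, up to scaling, are the
    directions of the lines through the apex. *)
Definition from_apex z : 'rV[C]_n := \row_i z 0 (widen_ord (leqnSn n) i).

Lemma apex_last : apex 0 ord_max = 1.
Proof. by rewrite mxE !eqxx. Qed.

Lemma from_apexD z1 z2 (a b : C) :
  from_apex (a *: z1 + b *: z2) = a *: from_apex z1 + b *: from_apex z2.
Proof. by apply/rowP => i; rewrite !mxE. Qed.

Lemma from_apex0 : from_apex apex = 0.
Proof.
apply/rowP => i; rewrite !mxE /= -val_eqE /=.
by rewrite ltn_eqF.
Qed.

Lemma from_apex_eq0 z : from_apex z = 0 -> z = z 0 ord_max *: apex.
Proof.
move=> z0; apply/rowP => i; rewrite !mxE /=.
case: (unliftP ord_max i) => [k ->|->]; last by rewrite eqxx mulr1.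
have := congr1 (fun v : 'rV_n => v 0 k) z0; rewrite !mxE.
have -> : widen_ord (leqnSn n) k = lift ord_max k.
  by apply: val_inj; rewrite /= /bump leqNgt ltn_ord.
by move=> ->; rewrite eq_sym (negPf (neq_lift _ _)) mulr0.
Qed.

Lemma branch_form_homog G : tuple_space G -> branch_form G \is (2 * m).-homog.
Proof.
have homX d : ('X_ord_max ^+ d : {mpoly C[n.+1]}) \is d.-homog.
  by rewrite mpolyXn dhomogX /= mdegMn mdeg1 mul1n.
move=> hG; rewrite rpredD // rpred_sum // => j _.
have -> : (2 * m = m - j.+1 + (m + j.+1))%N by have := ltn_ord j; lia.
by rewrite dhomogM // mwiden_homog.
Qed.

Lemma branch_form_eval G z :
  (branch_form G).@[z 0] = z 0 ord_max ^+ (2 * m) +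
    \sum_(j < m) z 0 ord_max ^+ (m - j.+1) * (G j).@[(from_apex z) 0].
Proof.
rewrite mevalD rmorphXn /= mevalXU raddf_sum; congr (_ + _).
apply: eq_bigr => j _ /=; rewrite mevalM rmorphXn /= mevalXU mwiden_meval.
by congr (_ * _); apply: meval_eq => i; rewrite mxE.
Qed.

(** On the line through the apex in the direction [z], with the parameters [a, t]
    normalized so that the last coordinate is 1, the branch form is 1 to order
    [m], and its higher coefficients are the values of the [G j]. *)
Lemma branch_form_cone G z (a t : C) : tuple_space G ->
  a + t * z 0 ord_max = 1 ->
  (branch_form G).@[(a *: apex + t *: z) 0] =
    1 + \sum_(j < m) t ^+ (m + j.+1) * (G j).@[(from_apex z) 0].
Proof.
move=> hG at1; rewrite branch_form_eval.
have -> : (a *: apex + t *: z) 0 ord_max = 1.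
  by rewrite !mxE !eqxx mulr1 at1.
rewrite expr1n from_apexD from_apex0 scaler0 add0r; congr (_ + _).
by apply: eq_bigr => j _; rewrite expr1n mul1r (form_scale _ _ (hG j)).
Qed.

Lemma branch_form_apex G : tuple_space G -> (branch_form G).@[apex 0] = 1.
Proof.
move=> hG; rewrite -[apex]scale1r -[1 *: _]addr0 -(scale0r 0).
rewrite branch_form_cone ?mul0r ?addr0 // big1 ?addr0 // => j _.
by rewrite addnS expr0n mul0r.
Qed.

(** The chain rule for the projection from the apex. *)
Lemma mwiden_dirderiv (p : {mpoly C[n]}) z w :
  dirderiv (mwiden p) z w = dirderiv p (from_apex z) (from_apex w).
Proof.
have evalE q : (mwiden q).@[z 0] = q.@[(from_apex z) 0].
  by rewrite mwiden_meval; apply: meval_eq => i; rewrite mxE.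
elim/mpoly_ring_ind: p => [c|i|p q Ep Eq|p q Ep Eq].
- by rewrite mwidenC !dirderivC.
- by rewrite mwidenX mnmwiden1 !dirderivXU mxE.
- by rewrite mwidenD !dirderivD Ep Eq.
- by rewrite mwidenM !dirderivM Ep Eq !evalE.
Qed.

Lemma branch_form_dirderiv G z : (0 < m)%N -> tuple_space G ->
  dirderiv (branch_form G) apex z = (2 * m)%:R * z 0 ord_max.
Proof.
move=> m_gt0 hG; rewrite dirderivD dirderiv_sum [X in _ + X]big1 => [|j _].
  rewrite addr0 -(prednK (n := 2 * m)) ?muln_gt0 // dirderivX mevalXU.
  by rewrite apex_last expr1n mulr1 dirderivXU.
have degG : (1 < m + j.+1)%N by lia.
rewrite dirderivM mwiden_dirderiv from_apex0 mwiden_meval.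
rewrite (form_dirderiv_at0 _ (hG j)) // mulr0 addr0.
rewrite -[X in _ * X](_ : 0 = _) ?mulr0 //.
rewrite -(form_at0 (hG j)) ?addnS // -from_apex0.
by apply: meval_eq => i; rewrite mxE.
Qed.

End BranchForm.

(** * Smoothness of the branch divisor for general tuples *)
Section Smoothness.
Variables (C : numClosedFieldType) (n m : nat).
Hypothesis m_gt0 : (0 < m)%N.
Implicit Types (G : 'I_m -> {mpoly C[n]}).

(** The factor makes the gradient of the Fermat form the tuple of the plain
    powers [X_i^(2m-1)]. *)
Definition gradient G (i : 'I_n.+1) : {mpoly C[n.+1]} :=
  (2 * m)%:R^-1 *: (branch_form G)^`M(i).

Definition discr G : C := \det (macaulay_mx (2 * m).-1 (gradient G)).

(** The tuple for which [branch_form] is the Fermat form of degree [2m]; the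
    index [j = m - 1] carries the degree [2m]. *)
Definition fermat (j : 'I_m) : {mpoly C[n]} :=
  if j.+1 == m then \sum_i 'X_i ^+ (2 * m) else 0.

Lemma discr_smooth G : tuple_space G -> discr G != 0 ->
  smooth_hypersurface (2 * m) (branch_form G).
Proof.
move=> hG nz; split; last move=> z z_nz _.
- apply/eqP => F0; have /eqP := branch_form_apex hG.
  by rewrite F0 meval0 eq_sym oner_eq0.
- exact: branch_form_homog.
have gradG i : gradient G i \is (2 * m).-1.-homog.
  by rewrite rpredZ // mderiv_homog // branch_form_homog.
have [i Gz] := macaulay_nonsingular gradG nz z_nz; exists i.
by apply: contraNneq Gz => Fz; rewrite mevalZ Fz mulr0.
Qed.

(** Since [branch_form G] is an affine function of [G], every linear functional
    of it, such as a coefficient of a multiple of a partial derivative, is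
    polynomial in the coefficients of [G]. *)
Lemma regular_affine (l : {mpoly C[n.+1]} -> C) :
  (forall p q, l (p + q) = l p + l q) -> (forall c p, l (c *: p) = c * l p) ->
  regular (fun G => l (branch_form G)).
Proof.
move=> lD lZ; have l_sum (I : finType) (F : I -> {mpoly C[n.+1]}) :
    l (\sum_i F i) = \sum_i l (F i).
  by apply: (big_morph l) => //; rewrite -(scale0r 0) lZ mul0r.
pose T := 'X_{1..n < (2 * m).+1}.
pose mon (j : 'I_m) (mu : T) : {mpoly C[n.+1]} :=
  'X_ord_max ^+ (m - j.+1) * mwiden 'X_[mu].
have [P E] : regular (fun G =>
    l ('X_ord_max ^+ (2 * m)) + \sum_j \sum_mu (G j)@_(bmnm mu) * l (mon j mu)).
  apply: regularD; first exact: regular_const.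
  apply: regular_sum => j; apply: regular_sum => mu.
  by apply: regularM; [apply: regular_coef | apply: regular_const].
exists P => G hG; rewrite -E // lD l_sum; congr (_ + _).
apply: eq_bigr => j _; rewrite (mwidenE (tuple_space_msize j hG)).
rewrite mulr_sumr l_sum; apply: eq_bigr => mu _.
by rewrite -scalerAr lZ /mon mwidenX.
Qed.

Lemma discr_regular : regular discr.
Proof.
apply: regular_det => a b.
set mu := bmnm (enum_val a); set nu := bmnm (enum_val b).
suff [P E] : regular (fun G =>
    (macaulay_row (2 * m).-1 (gradient G) mu)@_nu).
  by exists P => G /E <-; rewrite mxE.
rewrite /macaulay_row; case: pickP => [i _|_]; last exact: regular_const.
pose l (p : {mpoly C[n.+1]}) : C :=
  ('X_[(mu - U_(i) *+ (2 * m).-1)%MM] * ((2 * m)%:R^-1 *: p^`M(i)))@_nu.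
apply: (regular_affine (l := l)) => [p q|c p]; rewrite /l.
  by rewrite mderivD scalerDr mulrDr mcoeffD.
by rewrite mderivZ scalerA [_^-1 * c]mulrC -scalerA -scalerAr mcoeffZ.
Qed.

Lemma fermat_tuple_space : tuple_space fermat.
Proof.
move=> j; rewrite /fermat; case: eqP => [jm|_]; last exact: rpred0.
rewrite rpred_sum // => i _.
by rewrite mpolyXn dhomogX /= mdegMn mdeg1 mul1n jm addnn -mul2n.
Qed.

Lemma branch_form_fermat : branch_form fermat = \sum_i 'X_i ^+ (2 * m).
Proof.
have lt_j0 : (m.-1 < m)%N by rewrite prednK.
rewrite /branch_form (bigD1 (Ordinal lt_j0)) //= big1 => [|j ne_j].
  rewrite /fermat /= prednK // eqxx subnn expr0 mul1r addr0.
  rewrite big_ord_recr /= addrC raddf_sum; congr (_ + _).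
  by apply: eq_bigr => i _; rewrite /= rmorphXn /= mwidenX mnmwiden1.
rewrite /fermat; case: eqP => [jm|_]; last by rewrite mwiden0 mulr0.
by case/eqP: ne_j; apply: val_inj; have := congr1 predn jm.
Qed.

Lemma discr_fermat : discr fermat = 1.
Proof.
rewrite /discr macaulay_mx_powers ?det1 // => i.
rewrite /gradient branch_form_fermat (linear_sum (mderiv i)) (bigD1 i) //= big1 => [|j ji].
  rewrite addr0 mpolyXn mderivX mulmnE mnm1E eqxx mul1n.
  rewrite scalerA mulVf ?scale1r ?pnatr_eq0 -?lt0n ?muln_gt0 //.
  rewrite mpolyXn; congr 'X_[_]; apply/mnmP => j.
  by rewrite mnmBE !mulmnE mnm1E; case: eqP => _ ; lia.
by rewrite mpolyXn mderivX mulmnE mnm1E (negPf ji) scale0r.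
Qed.

End Smoothness.

(** * Minimal rational curves through the point over the apex *)
Section TangentDirections.
Variables (C : numClosedFieldType) (n m : nat).
Hypothesis m_gt0 : (0 < m)%N.
Variable G : 'I_m -> {mpoly C[n]}.
Hypothesis hG : tuple_space G.
Implicit Types (w : total_coord C n) (z : 'rV[C]_n.+1).
Let F := branch_form G.

Definition apex_lift : total_coord C n := (apex C n, 1).

Definition tangent_chart w : 'rV[C]_n := from_apex w.1.

Fact tangent_chart_is_linear : linear tangent_chart.
Proof.
by move=> a u v; rewrite /tangent_chart -[from_apex v.1]scale1r -from_apexD scale1r.
Qed.

HB.instance Definition _ := GRing.isLinear.Build C (total_coord C n) 'rV[C]_n
  *:%R tangent_chart tangent_chart_is_linear.

Lemma cone_tangent_apex w :
  cone_tangent F apex_lift w <-> w.2 = m%:R * w.1 0 ord_max.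
Proof.
have two_nz : 2 != 0 :> C by rewrite pnatr_eq0.
rewrite /cone_tangent /= mulr1 branch_form_dirderiv // natrM -mulrA.
by split=> [/(mulfI two_nz)|->].
Qed.

Lemma tangent_chart_surj u :
  exists2 w, cone_tangent F apex_lift w & tangent_chart w = u.
Proof.
exists (\row_i (if unlift ord_max i is Some k then u 0 k else 0), 0).
  by apply/cone_tangent_apex; rewrite /= mxE unlift_none mulr0.
apply/rowP => i; rewrite !mxE.
have -> : widen_ord (leqnSn n) i = lift ord_max i.
  by apply: val_inj; rewrite /= /bump leqNgt ltn_ord.
by rewrite liftK.
Qed.

Lemma tangent_chart_ker w : cone_tangent F apex_lift w ->
  (tangent_chart w = 0 <-> exists a : C, w = a *: euler m apex_lift).
Proof.
move=> /cone_tangent_apex w2; split=> [/from_apex_eq0 w1|[a ->]].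
  exists (w.1 0 ord_max); rewrite {1}[w]surjective_pairing w2 {1}w1.
  by rewrite /euler /= mulr1; congr pair; rewrite mulrC.
by rewrite linearZ /= /tangent_chart /= from_apex0 scaler0.
Qed.

Section Line.
Variable z : 'rV[C]_n.+1.
Hypothesis z_nz : from_apex z != 0.

Definition line_coord (i : 'I_n.+1) : {mpoly C[2]} :=
  apex C n 0 i *: 'X_ord0 + z 0 i *: 'X_ord_max.

Definition line_map : n.+1.-tuple {mpoly C[2]} := [tuple line_coord i | i < n.+1].

Definition line_section : {mpoly C[2]} := line_coord ord_max ^+ m.

Lemma line_mapE i : tnth line_map i = line_coord i.
Proof. by rewrite tnth_mktuple. Qed.

Lemma line_coord_homog i : line_coord i \is 1.-homog.
Proof. by rewrite rpredD ?rpredZ // dhomogX /= mdeg1. Qed.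

Lemma line_lift p : (curve_lift line_map line_section p).1 =
  p 0 ord0 *: apex C n + p 0 ord_max *: z.
Proof.
apply/rowP => i; rewrite !mxE /= line_mapE mevalD !mevalZ !mevalXU.
by rewrite !mxE [_ * p _ _]mulrC [z 0 i * _]mulrC.
Qed.

Lemma line_injective (p q : 'rV[C]_2) (a : C) :
  q 0 ord0 *: apex C n + q 0 ord_max *: z =
    a *: (p 0 ord0 *: apex C n + p 0 ord_max *: z) -> q = a *: p.
Proof.
have /rV0Pn[k zk] := z_nz.
move=> E; have : from_apex (q 0 ord0 *: apex C n + q 0 ord_max *: z) =
    from_apex (a *: (p 0 ord0 *: apex C n + p 0 ord_max *: z)) by rewrite E.
rewrite scalerDr !scalerA !from_apexD from_apex0 !scaler0 !add0r.
move=> /rowP/(_ k); rewrite !mxE in zk *; move=> /(mulIf zk) q1.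
have := congr1 (fun v : 'rV_n.+1 => v 0 ord_max) E.
rewrite !mxE /= !eqxx !mulr1 mulrDr mulrA q1 => /addIr q0.
apply/rowP => i; rewrite !mxE; case: i => [[|[|//]] lt].
  by have -> : Ordinal lt = ord0 by apply: val_inj.
by have -> : Ordinal lt = ord_max by apply: val_inj.
Qed.

Hypothesis z_root : forall j, (G j).@[(from_apex z) 0] = 0.

(** If [from_apex z] is a common zero of the [G j], only the term [X_n^(2m)] of
    the branch form survives on the line: it is the square of the [m]-th power
    of a linear form, so the line splits in the double cover. *)
Lemma line_section_square : line_section ^+ 2 = F \mPo line_map.
Proof.
have comp_mwiden (p : {mpoly C[n]}) : mwiden p \mPo line_map =
    mmap (@mpolyC 2 C) (fun i => line_coord (widen_ord (leqnSn n) i)) p.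
  elim/mpoly_ring_ind: p => [c|i|p q Ep Eq|p q Ep Eq].
  - by rewrite mwidenC comp_mpolyC mmapC.
  - by rewrite mwidenX mnmwiden1 comp_mpolyXU -tnth_nth line_mapE mmapX mmap1U.
  - by rewrite mwidenD comp_mpolyD mmapD Ep Eq.
  - by rewrite mwidenM !rmorphM /= Ep Eq.
have comp_const (u : 'I_n -> C) (p : {mpoly C[n]}) :
    mmap (@mpolyC 2 C) (fun i => (u i)%:MP) p = (p.@[u])%:MP.
  rewrite /mmap mevalE rmorph_sum; apply: eq_bigr => mu _ /=.
  rewrite rmorphM rmorph_prod; congr (_ * _); apply: eq_bigr => i _.
  by rewrite rmorphXn.
rewrite /F /branch_form comp_mpolyD rmorphXn /= comp_mpolyXU -tnth_nth line_mapE.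
rewrite linear_sum big1 ?addr0 => [|j _].
  by rewrite /line_section -exprM mulnC.
rewrite rmorphM /= comp_mwiden.
have E i : line_coord (widen_ord (leqnSn n) i) =
    'X_ord_max * ((from_apex z) 0 i)%:MP.
  have := congr1 (fun v : 'rV_n => v 0 i) (from_apex0 C n).
  by rewrite /line_coord !mxE => ->; rewrite scale0r add0r mulrC mul_mpolyC.
have -> : mmap (@mpolyC 2 C) (fun i => line_coord (widen_ord (leqnSn n) i)) (G j)
    = mmap (@mpolyC 2 C) (fun i => 'X_ord_max * ((from_apex z) 0 i)%:MP) (G j).
  by apply: eq_bigr => mu _; congr (_ * _); apply: mmap1_eq.
by rewrite (homog_mmap_scale _ _ _ (hG j)) comp_const z_root mpolyC0 !mulr0.
Qed.

Lemma line_minimal : minimal_rational_curve m F line_map line_section.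
Proof.
split; last first.
  exists (delta_mx 0 ord0); first by apply/rV0Pn; exists ord0; rewrite mxE oner_eq0.
  rewrite line_lift !mxE /= scale1r scale0r addr0 branch_form_apex //.
  exact: oner_neq0.
split; last first.
  exists [::] => p q _ _ _ [a a_nz [E _]]; exists a => //.
  by apply: line_injective; rewrite -!line_lift.
split.
- by move=> i; rewrite line_mapE line_coord_homog.
- by rewrite dhomogMn // line_coord_homog.
- move=> p p_nz; apply/existsP; apply: contraNT p_nz.
  rewrite negb_exists => /forallP f0.
  have lift0 : (curve_lift line_map line_section p).1 = 0.
    by apply/rowP => i; rewrite !mxE /=; apply/eqP; have := f0 i; rewrite negbK.
  apply/eqP; rewrite -[RHS](scale0r 0); apply: line_injective.
  by rewrite -line_lift lift0 scale0r.
exact: line_section_square.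
Qed.

End Line.
Lemma vmrt_of_root w : cone_tangent F apex_lift w -> tangent_chart w != 0 ->
  zero_locus G (tangent_chart w) -> vmrt m F apex_lift w.
Proof.
move=> tw w_nz [_ w_root]; split.
  move=> a wa; move/negP: w_nz; apply; apply/eqP/tangent_chart_ker => //.
  by exists a.
exists (line_map w.1), (line_section w.1), (delta_mx 0 ord0), (delta_mx 0 ord_max).
have lift0 : curve_lift (line_map w.1) (line_section w.1) (delta_mx 0 ord0) =
    apex_lift.
  rewrite [LHS]surjective_pairing line_lift !mxE /= scale1r scale0r addr0.
  congr pair; rewrite /line_section rmorphXn /= mevalD !mevalZ !mevalXU !mxE /=.
  by rewrite eqxx mulr1 mulr0 addr0 expr1n.
split=> //.
- exact: line_minimal.
- by apply/rV0Pn; exists ord0; rewrite mxE oner_eq0.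
rewrite [LHS]surjective_pairing; move/cone_tangent_apex: tw => ->.
congr pair.
  apply/rowP => i; rewrite !mxE line_mapE linear_form_dirderiv ?line_coord_homog //.
  by rewrite mevalD !mevalZ !mevalXU !mxE /= mulr0 add0r mulr1.
rewrite /line_section -(prednK m_gt0) dirderivX linear_form_dirderiv ?line_coord_homog //.
rewrite !mevalD !mevalZ !mevalXU !mxE /=.
by rewrite eqxx !mulr1 !mulr0 addr0 add0r expr1n mulr1.
Qed.

(** A minimal rational curve through the point in the direction [w] exhibits the
    restriction of the branch form to a line as the square of a form [g] of
    degree [m].  In the normalization of [branch_form_cone] this reads
    [h^2 = 1 + t^(m+1) s], where the coefficients of [s] are the values of the
    [G j], and [square_congr_1] gives [s = 0]. *)
Lemma root_of_vmrt w : cone_tangent F apex_lift w -> tangent_chart w != 0 ->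
  vmrt m F apex_lift w -> zero_locus G (tangent_chart w).
Proof.
move=> tw w_nz [_ [f [g [p [q [min _ lift_p diff_q]]]]]].
have [[[f_homog g_homog _ gF] _] _] := min; rewrite mul1n in g_homog.
pose c := w.1 0 ord_max; pose u := from_apex w.1.
(* The last coordinate of the image of (1 - t c) p + t q is 1 for all t. *)
pose h := on_line (p 0) ((q - c *: p) 0) g.
have fp i : (tnth f i).@[p 0] = apex C n 0 i.
  by rewrite -[apex C n]/apex_lift.1 -lift_p mxE.
have fq i : (tnth f i).@[q 0] = w.1 0 i.
  by rewrite diff_q mxE linear_form_dirderiv.
have h_eval t : h.[t] = g.@[((1 - t * c) *: p + t *: q) 0].
  rewrite horner_on_line; apply: meval_eq => i; rewrite !mxE; ring.
have h_sq t : h.[t] ^+ 2 = 1 + \sum_(j < m) t ^+ (m + j.+1) * (G j).@[u 0].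
  rewrite h_eval -rmorphXn /= gF comp_mpoly_meval.
  rewrite -(branch_form_cone (a := 1 - t * c) hG) ?subrK //.
  apply: meval_eq => i; rewrite linear_form_add // fp fq !mxE; ring.
pose s : {poly C} := \poly_(j < m) (if insub j is Some k then (G k).@[u 0] else 0).
have sE (j : 'I_m) : s`_j = (G j).@[u 0] by rewrite coef_poly ltn_ord valK.
have s0 : s = 0.
  apply: (square_congr_1 (h := h) (m := m)); first exact: size_on_line.
    rewrite h_eval mul0r subr0 scale1r scale0r addr0.
    by have := congr1 snd lift_p.
  apply: poly_eq_fun => t; rewrite horner_exp h_sq hornerD hornerC hornerM hornerXn.
  congr (_ + _); rewrite horner_poly mulr_sumr; apply: eq_bigr => j _.
  by rewrite valK -addSnnS exprD -mulrA [_ * t ^+ j]mulrC.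
by split=> // j; rewrite -sE s0 coef0.
Qed.

Lemma branch_form_vmrt : vmrt_proj_iso m F apex_lift (zero_locus G).
Proof.
exists tangent_chart; split; first exact: tangent_chart_surj.
- exact: tangent_chart_ker.
by move=> w tw w_nz; split; [apply: root_of_vmrt | apply: vmrt_of_root].
Qed.

End TangentDirections.

(** * General complete intersections as varieties of minimal rational tangents *)

Local Open Scope complex_scope.

Theorem theorem1p2 (R : realType) (n m : nat)
    (hn : (3 <= n)%N) (hm : (2 <= m <= n - 1)%N) :
  exists U : ('I_m -> {mpoly R[i][n]}) -> Prop,
    [/\ zariski_open U,
        zariski_dense U &
        forall G : 'I_m -> {mpoly R[i][n]}, tuple_space G -> U G ->
          exists F : {mpoly R[i][n.+1]},
            smooth_hypersurface (2 * m) F /\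
            exists x : total_coord R[i] n,
              [/\ on_double_cover F x,
                  F.@[x.1 0] != 0 &
                  vmrt_proj_iso m F x (zero_locus G)]].
Proof.
have m_gt0 : (0 < m)%N by case/andP: hm => /ltnW.
exists (fun G => discr G != 0); split.
- exact/nonvanishing_open/discr_regular.
- apply: (nonvanishing_dense (h := @discr R[i] n m) (G1 := @fermat R[i] n m)); first exact: discr_regular.
    exact: fermat_tuple_space.
  by rewrite discr_fermat // oner_eq0.
move=> G hG discr_nz; exists (branch_form G); split; first exact: discr_smooth.
exists (apex_lift R[i] n); split.
- split; last by rewrite branch_form_apex //= expr1n.
  by apply/rV0Pn; exists ord_max; rewrite apex_last oner_eq0.
- by rewrite branch_form_apex // oner_eq0.
exact: branch_form_vmrt.
Qed.
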